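(* Let $G$ be an ordered graph with edge set $E$. Then $$\{\text{orientations } \vec G \text{ of } G\}=\biguplus\ \Bigl\{\vec G \ \Big|\ \vec G(F_k)/F_{k-1}\ (1\le k\le\iota)\text{ is bipolar w.r.t. }\min(F_k\setminus F_{k-1}),\text{ and }\vec G(F'_{k-1})/F'_k\ (1\le k\le\varepsilon)\text{ is cyclic-bipolar w.r.t. }\min(F'_{k-1}\setminus F'_k)\Bigr\},$$ where the disjoint union is over all connected filtrations $(F'_\varepsilon,\ldots,F'_0,F_c,F_0,\ldots,F_\iota)$ of $G$ (with arbitrary $\iota,\varepsilon\ge 0$), and where in each set $\vec G$ ranges over orientations of $G$. Moreover, the connected filtration of $G$ associated with an orientation $\vec G$ in the right-hand side is the active filtration of $\vec G$.
   Context: Graphs are finite, may have loops and multiple edges, and are connected unless they arise as minors (isolated vertices are ignored). For a graph $G$ with edge set $E$ and $F\subseteq E$, $G(F)$ is the restriction of $G$ to the edges in $F$ (deletion of $E\setminus F$) and $G/F$ is the contraction of $F$; similarly for digraphs. Cycles and cocycles (inclusion-minimal non-empty edge cuts) are regarded as edge subsets. An ordered (di)graph is one whose edge set is linearly ordered; minors inherit the order. An orientation $\vec G$ of $G$ is a digraph with underlying graph $G$. A cycle is directed if its edges are consistently oriented along it; a cocycle is directed if all its edges go from one side of the cut to the other. $\subset$ denotes strict inclusion. A digraph is bipolar w.r.t. an edge $p$ if it is acyclic with a unique source and a unique sink, which are the extremities of $p$ (equivalently: every edge is in a directed cocycle and every directed cocycle contains $p$); in particular a single isthmus $p$ is bipolar.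 It is cyclic-bipolar w.r.t. $p$ if every edge is in a directed cycle and every directed cycle contains $p$ (equivalently: it is a single loop $p$, or it has at least two edges and reversing $p$ gives a digraph bipolar w.r.t. $p$). A filtration of $G$ (or of $E$) is a sequence $(F'_\varepsilon,\ldots,F'_0,F_c,F_0,\ldots,F_\iota)$ of subsets of $E$ with $\emptyset=F'_\varepsilon\subset\cdots\subset F'_0=F_c=F_0\subset\cdots\subset F_\iota=E$, such that $\min(F_k\setminus F_{k-1})$, $1\le k\le\iota$, is increasing with $k$ and $\min(F'_{k-1}\setminus F'_k)$, $1\le k\le\varepsilon$, is increasing with $k$. It is connected if for every $1\le k\le\iota$ the minor $G(F_k)/F_{k-1}$ is either loopless and 2-connected with at least two edges, or a single isthmus, and for every $1\le k\le\varepsilon$ the minor $G(F'_{k-1})/F'_k$ is either loopless and 2-connected with at least two edges, or a single loop. (2-connected means 2-vertex-connected; a loopless graph on two vertices with at least one edge counts as 2-connected.) For an ordered digraph $\vec G$, a dual-active edge is the smallest edge of some directed cocycle, an active edge is the smallest edge of some directed cycle. Let $a_1<\cdots<a_\iota$ be the dual-active edges and $a'_1<\cdots<a'_\varepsilon$ the active edges. The active filtration of $\vec G$ is $\emptyset=F'_\varepsilon\subset\cdots\subset F'_0=F_c=F_0\subset\cdots\subset F_\iota=E$, where $F_c$ is the union of all directed cycles (equivalently, the complement of the union of all directed cocycles), $F_k=E\setminus\bigcup\{D: D\text{ directed cocycle},\ \min(D)\ge a_{k+1}\}$ for $0\le k\le\iota-1$, and $F'_k=\bigcup\{C: C\text{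 directed cycle},\ \min(C)\ge a'_{k+1}\}$ for $0\le k\le\varepsilon-1$. *)

(* Defs.v *)
From HB Require Import structures.
From mathcomp Require Import all_boot all_order.

Set Implicit Arguments.
Unset Strict Implicit.
Unset Printing Implicit Defensive.

(* The edge set of a (di)graph is a finite subset of an ambient type E, so that
   minors have edges of the same type.  Isolated vertices are ignored: the
   vertices that count are those incident with an edge, see [verts]. *)

Section Graphs.
Variables V E : finType.

Record graph := Graph {
  edges : {set E};
  ends : E -> {set V};   (* a singleton for a loop *)
  ends_card : forall e, e \in edges -> 0 < #|ends e| <= 2 }.

Implicit Types (G : graph) (F : {set E}).

Definition verts G : {set V} := \bigcup_(e in edges G) ends G e.

Definition joined G : rel V :=
  fun u v => [exists e in edges G, (u \in ends G e) && (v \in ends G e)].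

Definition graph_connected G : Prop :=
  {in verts G &, forall u v, connect (joined G) u v}.

Fact restrict_card G F e :
  e \in edges G :&: F -> 0 < #|ends G e| <= 2.
Proof. by case/setIP => /ends_card. Qed.

Definition restrict G F : graph := Graph (@restrict_card G F).

(* Every vertex is sent to a representative of its connected component in G(F);
   the other vertices of the component become isolated. *)
Definition contract_vertex G F : V -> V := root (joined (restrict G F)).

Fact contract_card G F e :
  e \in edges G :\: F -> 0 < #|contract_vertex G F @: ends G e| <= 2.
Proof.
case/setDP => /ends_card /andP[e0 e2] _; apply/andP; split.
  by move: e0; rewrite !card_gt0 imset_eq0.
exact: leq_trans (leq_imset_card _ _) e2.
Qed.

Definition contract G F : graph := Graph (@contract_card G F).

Definition loopless G : Prop := forall e, e \in edges G -> #|ends G e| = 2.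

(* The vertices left isolated by the deletion of w do count here. *)
Definition two_connected G : Prop :=
  [/\ 1 < #|verts G|,
      graph_connected G &
      forall w, w \in verts G -> {in verts G :\ w &, forall u v,
        connect (fun x y => [&& x != w, y != w & joined G x y]) u v}].

Definition single_isthmus G : Prop :=
  exists2 e, edges G = [set e] & #|ends G e| = 2.

Definition single_loop G : Prop :=
  exists2 e, edges G = [set e] & #|ends G e| = 1.

Definition cut G (A : {set V}) : {set E} :=
  [set e in edges G | (ends G e :&: A != set0) && (ends G e :\: A != set0)].

Definition cocycle G (C : {set E}) : bool :=
  minset [pred X : {set E} | (X != set0) && [exists A, X == cut G A]] C.

Record digraph := Digraph {
  dedges : {set E};
  src : E -> V;
  tgt : E -> V }.

Implicit Types D : digraph.

Fact underlying_card D e :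
  e \in dedges D -> 0 < #|[set src D e; tgt D e]| <= 2.
Proof. by move=> _; rewrite cards2; case: (_ != _). Qed.

Definition underlying D : graph := Graph (@underlying_card D).

Definition orientation G D : Prop :=
  dedges D = edges G /\
  forall e, e \in edges G -> ends G e = [set src D e; tgt D e].

Definition drestrict D F : digraph :=
  Digraph (dedges D :&: F) (src D) (tgt D).

Definition dcontract D F : digraph :=
  let r := contract_vertex (underlying D) F in
  Digraph (dedges D :\: F) (r \o src D) (r \o tgt D).

(* The length of a cycle is bounded by the number of edges, which makes this a
   boolean predicate; [dicycleP] is the usual definition. *)
Definition dicycle D (C : {set E}) : bool :=
  (C \subset dedges D) &&
  [exists k : 'I_#|E|, [exists s : k.+1.-tuple E,
     [&& C == [set e in s], uniq (map (src D) s)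
       & cycle (fun e f => tgt D e == src D f) s]]].

Lemma dicycleP D C :
  reflect (exists s : seq E,
             [/\ s != [::], {subset s <= dedges D}, C = [set e in s],
                 uniq (map (src D) s)
               & cycle (fun e f => tgt D e == src D f) s])
          (dicycle D C).
Proof.
apply: (iffP andP) => [[sCD /existsP[k /existsP[s /and3P[/eqP defC Us cs]]]]
                      | [s [s0 sD defC Us cs]]].
  exists s; split=> //; first by rewrite -size_eq0 size_tuple.
  by move=> e se; apply: (subsetP sCD); rewrite defC inE.
split; first by apply/subsetP=> e; rewrite defC inE => /sD.
have lt_s : (size s).-1 < #|E|.
  rewrite prednK ?lt0n ?size_eq0 // -(card_uniqP (map_uniq Us)).
  exact: max_card.
apply/existsP; exists (Ordinal lt_s).
have sz : size s == (size s).-1.+1 by rewrite prednK // lt0n size_eq0.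
by apply/existsP; exists (Tuple sz); apply/and3P; split=> //; apply/eqP.
Qed.

Definition dicocycle D (C : {set E}) : bool :=
  cocycle (underlying D) C &&
  [exists A : {set V}, (C == cut (underlying D) A) &&
     [forall e in C, (src D e \in A) && (tgt D e \notin A)]].

Definition acyclic D : Prop := forall C, ~~ dicycle D C.

Definition sources D : {set V} :=
  [set v in verts (underlying D) | [forall e in dedges D, tgt D e != v]].

Definition sinks D : {set V} :=
  [set v in verts (underlying D) | [forall e in dedges D, src D e != v]].

Definition bipolar D (p : E) : Prop :=
  [/\ p \in dedges D, acyclic D &
      exists s t, [/\ sources D = [set s], sinks D = [set t]
                    & [set src D p; tgt D p] = [set s; t]]].

Definition cyclic_bipolar D (p : E) : Prop :=
  [/\ p \in dedges D,
      forall e, e \in dedges D -> exists2 C, dicycle D C & e \in C &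
      forall C, dicycle D C -> p \in C].

End Graphs.

Section Filtrations.
Context {d : Order.disp_t} {V : finType} {E : finOrderType d}.
Implicit Types (G : graph V E) (D : digraph V E).

Definition is_min (A : {set E}) (e : E) : bool :=
  (e \in A) && [forall x in A, (e <= x)%O].

(* [Fdown] is (F'_0, ..., F'_epsilon) and [Fup] is (F_0, ..., F_iota), so that
   in both sequences the position is the index. *)
Record fseq := Fseq {
  Fdown : seq {set E};
  Fcyc : {set E};
  Fup : seq {set E} }.

Implicit Type f : fseq.

Definition iota_of f : nat := (size (Fup f)).-1.
Definition epsilon_of f : nat := (size (Fdown f)).-1.
Definition F_ f (k : nat) : {set E} := nth set0 (Fup f) k.
Definition F'_ f (k : nat) : {set E} := nth set0 (Fdown f) k.

Definition up_step f (k : nat) : {set E} := F_ f k :\: F_ f k.-1.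
Definition down_step f (k : nat) : {set E} := F'_ f k.-1 :\: F'_ f k.

Record filtration G f : Prop := Filtration {
  Fup_nonempty : 0 < size (Fup f);
  Fdown_nonempty : 0 < size (Fdown f);
  filtration_F0 : F_ f 0 = Fcyc f;
  filtration_F'0 : F'_ f 0 = Fcyc f;
  filtration_top : F_ f (iota_of f) = edges G;
  filtration_bot : F'_ f (epsilon_of f) = set0;
  filtration_up : forall k, 1 <= k <= iota_of f -> F_ f k.-1 \proper F_ f k;
  filtration_down :
    forall k, 1 <= k <= epsilon_of f -> F'_ f k \proper F'_ f k.-1;
  filtration_up_min : forall j k a b, 1 <= j < k -> k <= iota_of f ->
    is_min (up_step f j) a -> is_min (up_step f k) b -> (a < b)%O;
  filtration_down_min : forall j k a b, 1 <= j < k -> k <= epsilon_of f ->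
    is_min (down_step f j) a -> is_min (down_step f k) b -> (a < b)%O }.

Definition up_minor G f (k : nat) : graph V E :=
  contract (restrict G (F_ f k)) (F_ f k.-1).

Definition down_minor G f (k : nat) : graph V E :=
  contract (restrict G (F'_ f k.-1)) (F'_ f k).

Definition up_dminor D f (k : nat) : digraph V E :=
  dcontract (drestrict D (F_ f k)) (F_ f k.-1).

Definition down_dminor D f (k : nat) : digraph V E :=
  dcontract (drestrict D (F'_ f k.-1)) (F'_ f k).

Definition block G : Prop :=
  [/\ loopless G, two_connected G & 1 < #|edges G|].

Definition connected_filtration G f : Prop :=
  [/\ filtration G f,
      forall k, 1 <= k <= iota_of f ->
        block (up_minor G f k) \/ single_isthmus (up_minor G f k) &
      forall k, 1 <= k <= epsilon_of f ->
        block (down_minor G f k) \/ single_loop (down_minor G f k)].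

Definition filtration_orientation G f D : Prop :=
  [/\ orientation G D,
      forall k, 1 <= k <= iota_of f ->
        exists2 p, is_min (up_step f k) p & bipolar (up_dminor D f k) p &
      forall k, 1 <= k <= epsilon_of f ->
        exists2 p, is_min (down_step f k) p
                 & cyclic_bipolar (down_dminor D f k) p].

Definition active_edges D : {set E} :=
  [set e | [exists C, dicycle D C && is_min C e]].

Definition dual_active_edges D : {set E} :=
  [set e | [exists C, dicocycle D C && is_min C e]].

Definition increasing (A : {set E}) : seq E := sort <=%O (enum A).

Definition min_ge (C : {set E}) (a : E) : bool :=
  [exists m, is_min C m && (a <= m)%O].

Definition active_filtration D : fseq :=
  Fseq
    (rcons [seq \bigcup_(C : {set E} | dicycle D C && min_ge C a) C
               | a <- increasing (active_edges D)]
           set0)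
    (\bigcup_(C : {set E} | dicycle D C) C)
    (rcons [seq dedges D :\:
                  \bigcup_(C : {set E} | dicocycle D C && min_ge C a) C
               | a <- increasing (dual_active_edges D)]
           (dedges D)).

End Filtrations.

Arguments fseq {d} E.

(* Main.v *)
Require Import Defs.
From mathcomp Require Import all_boot all_order.

Set Implicit Arguments.
Unset Strict Implicit.
Unset Printing Implicit Defensive.

Import Order.TTheory.

(** For sets R and S of edges of a digraph D, let [cl D R S] be the set of the
    edges of R whose head is joined to their tail by a walk that follows edges
    of R forwards and edges of S backwards.  Two extreme cases matter, where A
    is the set of all edges.  For S empty, this is the union of the directed
    cycles contained in R ([cl0_dicycleP]).  For R = A, the complement of this
    set is the union of the directed cocycles that avoid S, because the
    vertices that no such walk reaches from the head of an edge form a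
    directed cut ([setD_cl_dicocycleP]).  Hence every member of the active
    filtration has the form [cl D A {x < a}] or [cl D {x >= a} 0].

    Both S |-> [cl D A S] and its dual S |-> A \ [cl D (A \ S) 0] are closure
    operators on A.  An edge a is dual-active, respectively active, when it is
    outside the closure of the set of smaller edges.  The two halves of the
    active filtration are thus one construction, applied to two closure
    operators c on a linearly ordered set: the chain of the closures of the
    initial segments below the active elements.  Among the increasing chains
    from the closure of the empty set to A, it is characterized by
        s_k = c (p_k + s_(k-1)),  p_k = min (s_k \ s_(k-1)),  p_k increasing.
    The active chain has these properties because c of an initial segment is
    already the closure of the active elements in it ([active_flagP]).  It is
    the only one because p_k has to be the least element outside s_(k-1), so
    that the chain is determined step by step ([flag_uniq]).

    It remains to translate the conditions on the minors.  In terms of closures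
    a digraph with edge set A is bipolar w.r.t. p iff [cl A 0] = 0 and
    [cl A p] = A, and cyclic-bipolar iff [cl A 0] = A and [cl (A \ p) 0] = 0.
    Closures commute with contraction ([cl_minor]), so that the minor D(Y)/X is
    bipolar iff X is closed in Y and Y is the closure of p + X in Y, and
    dually.  Closedness in the next member of the chain amounts to closedness
    in A by induction along the chain: from A inwards in the bipolar half
    ([cl_restrict]), from the empty set outwards in the cyclic half
    ([cl_absorb]).  Therefore the orientations attached to a filtration are
    exactly those of which it is the active filtration ([flags_filtration] and
    [filtration_flags]).  Such a filtration is connected since every vertex of
    a bipolar digraph lies on a directed path from the source to the sink, and
    these two are adjacent ([st_two_connected]). *)

(** * Reachability in finite relations *)

Section Relations.
Variable T : finType.
Implicit Types r : rel T.

(** A walk that uses the additional arc (a, b) can be cut before its first and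
    after its last use of that arc. *)
Lemma connect_add_arc r r' a b :
    (forall x y, r' x y -> r x y \/ x = a /\ y = b) ->
  forall u v, connect r' u v ->
    connect r u v \/ connect r u a /\ connect r b v.
Proof.
move=> sub u v /connectP[q]; elim: q u => [|w q IHq] u /=.
  by move=> _ ->; left.
case/andP=> /sub step_uw path_q def_v.
have := IHq w path_q def_v.
case=> [wv | [wa bv]]; case: step_uw => [uw | [def_u def_w]]; subst.
- by left; apply: connect_trans (connect1 uw) wv.
- by right.
- by right; split=> //; apply: connect_trans (connect1 uw) wa.
- by right.
Qed.

(** Among the points from which v can be reached, one with fewest ancestors
    lies in a source component. *)
Lemma connect_minimal r v :
  exists w, connect r w v /\ forall u, connect r u w -> connect r w u.
Proof.
pose anc w := [set u | connect r u w].
case: (@arg_minnP _ v (connect r ^~ v) (fun w => #|anc w|)) => // w wv minw.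
exists w; split=> // u uw.
have sub : anc u \subset anc w.
  by apply/subsetP=> x; rewrite !inE => /connect_trans; apply.
have : w \in anc u.
  suff -> : anc u = anc w by rewrite inE.
  by apply/eqP; rewrite eqEcard sub minw ?(connect_trans uw).
by rewrite inE.
Qed.

Lemma connect_maximal r v :
  exists w, connect r v w /\ forall u, connect r w u -> connect r u w.
Proof.
have [w [wv maxw]] := connect_minimal [rel x y | r y x] v.
have rev x y : connect [rel x y | r y x] x y = connect r y x.
  by rewrite connect_rev.
by exists w; rewrite -rev; split=> // u; rewrite -!rev => /maxw.
Qed.

Lemma connect_to_source r u v : (forall x, ~~ r x v) -> connect r u v -> u = v.
Proof.
move=> nrv /connectP[q]; elim: q u => [|w q IHq] u //= /andP[uw wq] def_v.
by have wv := IHq w wq def_v; rewrite wv (negPf (nrv u)) in uw.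
Qed.

Lemma connect_from_sink r u v : (forall x, ~~ r u x) -> connect r u v -> u = v.
Proof.
by move=> nru /connectP[[|w q] //= /andP[uw]]; rewrite (negPf (nru w)) in uw.
Qed.

End Relations.

(** * The closure of a set of edges in a digraph *)

Section EdgeClosure.
Variables V E : finType.
Implicit Types (D : digraph V E) (R S X Y : {set E}) (A B : {set V}).

(** Making the edges of S bidirected has the same effect on walks as
    contracting them, but leaves the vertices unchanged. *)
Definition step D R S : rel V := fun x y =>
  [exists e, (e \in R) && (src D e == x) && (tgt D e == y)
          || (e \in S) && (tgt D e == x) && (src D e == y)].

Definition reach D R S : rel V := connect (step D R S).

Definition cl D R S : {set E} :=
  [set e in R | reach D R S (tgt D e) (src D e)].

Lemma stepP D R S x y :
  reflect (exists e, [/\ e \in R, src D e = x & tgt D e = y]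
                  \/ [/\ e \in S, tgt D e = x & src D e = y])
          (step D R S x y).
Proof.
apply: (iffP existsP) => -[e].
  by case/orP=> /andP[/andP[? /eqP ?] /eqP ?]; exists e; [left | right].
by case=> -[eR <- <-]; exists e; rewrite eR !eqxx ?orbT.
Qed.

Lemma reach_fwd D R S e : e \in R -> reach D R S (src D e) (tgt D e).
Proof. by move=> eR; apply/connect1/stepP; exists e; left. Qed.

Lemma reach_bwd D R S e : e \in S -> reach D R S (tgt D e) (src D e).
Proof. by move=> eS; apply/connect1/stepP; exists e; right. Qed.

(** A backward use of an edge of the closure can be replaced by the walk from
    its head to its tail that puts it there. *)
Lemma reach_sub D R S R' S' : R \subset R' -> S \subset cl D R' S' :|: S' ->
  subrel (reach D R S) (reach D R' S').
Proof.
move=> /subsetP sR /subsetP sS; apply: connect_sub => x y /stepP[e].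
case=> -[eRS <- <-]; first exact/reach_fwd/sR.
by case/setUP: (sS e eRS) => [|/(reach_bwd D R')//]; rewrite inE => /andP[].
Qed.

Lemma cl_sub D R S : cl D R S \subset R.
Proof. by apply/subsetP=> e; rewrite inE => /andP[]. Qed.

Lemma sub_cl D R S : S \subset R -> S \subset cl D R S.
Proof.
move=> /subsetP sSR; apply/subsetP=> e eS.
by rewrite inE sSR ?reach_bwd.
Qed.

Lemma cl_least D R S R' S' :
  R \subset R' -> S \subset cl D R' S' :|: S' -> cl D R S \subset cl D R' S'.
Proof.
move=> sR sS; apply/subsetP=> e; rewrite !inE => /andP[eR].
by rewrite (subsetP sR) // => /(reach_sub sR sS).
Qed.

Lemma cl_mono D R S R' S' :
  R \subset R' -> S \subset S' -> cl D R S \subset cl D R' S'.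
Proof.
by move=> sR sS; apply: cl_least => //; apply: subset_trans sS (subsetUr _ _).
Qed.

Lemma cl_idem D R S : S \subset R -> cl D R (cl D R S) = cl D R S.
Proof.
move=> sSR; apply/eqP; rewrite eqEsubset cl_least ?subsetUl //=.
by rewrite cl_mono ?sub_cl.
Qed.

Lemma cl_full D R : cl D R R = R.
Proof. by apply/eqP; rewrite eqEsubset cl_sub sub_cl. Qed.

(** An edge in the closure lies on a closed walk, all of whose forward edges
    are in the closure as well: they can be taken from any Y that contains it.
    So a set that is closed in a closed set is closed. *)
Lemma cl_restrict D R S Y :
  Y \subset R -> cl D R S \subset Y -> cl D Y S = cl D R S.
Proof.
move=> sYR /subsetP sclY; apply/eqP; rewrite eqEsubset cl_mono //=.
have reachY u v : reach D R S u v -> reach D R S v u -> reach D Y S u v.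
  case/connectP=> q; elim: q u => [|w q IHq] u /=.
    by move=> _ -> _; apply: connect0.
  case/andP=> uw wq def_v vu.
  have wv : reach D R S w v by apply/connectP; exists q.
  have vw : reach D R S v w := connect_trans vu (connect1 uw).
  apply: connect_trans (IHq w wq def_v vw); apply/connect1/stepP.
  case/stepP: uw => e [] [eRS def_u def_w]; exists e; last by right.
  left; split=> //; apply: sclY; rewrite inE eRS def_u def_w.
  exact: connect_trans wv vu.
apply/subsetP=> e e_cl; rewrite inE sclY //=; move: e_cl; rewrite inE.
by case/andP=> eR /reachY-> //; apply: reach_fwd.
Qed.

(** If every edge of X is on a directed cycle inside X, then walking backwards
    along X is the same as walking forwards around these cycles. *)
Lemma cl_absorb D R X :
  X \subset R -> cl D X set0 = X -> cl D R X = cl D R set0.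
Proof.
move=> sXR defX; apply/eqP; rewrite eqEsubset andbC cl_mono ?sub0set //=.
by rewrite cl_least // setU0 -{1}defX cl_mono.
Qed.

(** * Directed cycles and cocycles *)

Lemma cl0_dicycleP D R e : R \subset dedges D ->
  reflect (exists C, [/\ dicycle D C, C \subset R & e \in C])
          (e \in cl D R set0).
Proof.
move=> /subsetP sRD; rewrite inE; apply: (iffP andP) => [[eR]|].
  case/connectP=> q0 path_q0 last_q0; case/shortenP: path_q0 last_q0 => q.
  move=> path_q uniq_q _ {q0} def_e.
  (* A list of edges along the vertex path; its tails are the vertices passed,
     hence distinct. *)
  have [s [ss sR def_q cs]] : exists s, [/\ map (src D) s = belast (tgt D e) q,
      {subset s <= R}, map (tgt D) s = q
    & path (fun e f => tgt D e == src D f) e s].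
    move: {eR uniq_q def_e} path_q; elim: q e => [|y q IHq] e /=.
      by exists [::].
    case/andP=> /stepP[f [[fR def_f <-]|[]]]; last by rewrite inE.
    case/IHq=> s [ss sR def_q cs]; exists (f :: s) => /=.
    rewrite ss def_q cs def_f eqxx; split=> // g.
    by rewrite inE => /predU1P[-> | /sR].
  exists [set f in e :: s]; split; last by rewrite !inE eqxx.
    apply/dicycleP; exists (e :: s); split=> //.
    - by move=> f; rewrite inE => /predU1P[-> | /sR]; apply: sRD.
    - by rewrite /= ss def_e -rcons_uniq -lastI.
    rewrite /= rcons_path cs -(last_map (tgt D)) def_q {1}def_e.
    by case: (q) => //=.
  by apply/subsetP=> f; rewrite !inE => /predU1P[-> | /sR].
case=> C [/dicycleP[s [_ _ -> _ cycle_s]] sR]; rewrite inE => e_s.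
have eR : e \in R by apply: (subsetP sR); rewrite inE.
split=> //; case/rot_to: (e_s) => i s' def_s'.
have sR' : {subset e :: s' <= R}.
  by move=> f; rewrite -def_s' mem_rot => f_s; apply: (subsetP sR); rewrite inE.
move: cycle_s; rewrite -(rot_cycle i) def_s' /= => path_s'.
have {path_s'}: path (fun e f => tgt D e == src D f) e s' &&
                (tgt D (last e s') == src D e).
  by rewrite rcons_path in path_s'.
move: (src D e) sR' => y {def_s' e_s eR}.
elim: s' e => [|f s' IHs] e sR' /=.
  by move/eqP=> <-; apply: connect0.
rewrite -andbA => /andP[/eqP-> path_s'].
apply: connect_trans (reach_fwd _ _ (sR' f _)) _.
  by rewrite !inE eqxx orbT.
by apply: IHs => // g g_s; apply: sR'; rewrite inE g_s orbT.
Qed.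

Lemma dicycle_neq0 D C : dicycle D C -> exists e, e \in C.
Proof.
by case/dicycleP=> -[|e s] [// _ _ -> _ _]; exists e; rewrite !inE eqxx.
Qed.

Lemma dicycle_sub D C : dicycle D C -> C \subset dedges D.
Proof. by case/andP. Qed.

Lemma mem_cut D A e : (e \in cut (underlying D) A) =
  (e \in dedges D) && ((src D e \in A) (+) (tgt D e \in A)).
Proof.
rewrite inE /=; congr (_ && _).
have -> : ([set src D e; tgt D e] :&: A != set0) =
          (src D e \in A) || (tgt D e \in A).
  apply/set0Pn/orP=> [[x] | [] ?]; last 2 first.
  - by exists (src D e); rewrite !inE eqxx.
  - by exists (tgt D e); rewrite !inE eqxx orbT.
  by rewrite !inE => /andP[/orP[]/eqP-> ?]; [left | right].
have -> : ([set src D e; tgt D e] :\: A != set0) =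
          (src D e \notin A) || (tgt D e \notin A).
  apply/set0Pn/orP=> [[x] | [] nA]; last 2 first.
  - by exists (src D e); rewrite !inE nA eqxx.
  - by exists (tgt D e); rewrite !inE nA eqxx orbT.
  by rewrite !inE => /andP[nA /orP[]/eqP<-]; [left | right].
by do 2!case: (_ \in A).
Qed.

(** These are the sets of vertices whose cut is a directed cut that leaves
    them. *)
Definition initial D A : bool :=
  [forall e in dedges D, (tgt D e \in A) ==> (src D e \in A)].

Lemma initialP D A : reflect
  {in dedges D, forall e, tgt D e \in A -> src D e \in A} (initial D A).
Proof.
apply: (iffP forallP) => iA e.
  by move=> eD; move/implyP: (iA e) => /(_ eD)/implyP.
by apply/implyP=> eD; apply/implyP/iA.
Qed.

Lemma initial_cut D A e : initial D A ->
  (e \in cut (underlying D) A) =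
  [&& e \in dedges D, src D e \in A & tgt D e \notin A].
Proof.
move/initialP=> iA; rewrite mem_cut; case eD: (e \in _) => //=.
by have := iA e eD; case: (_ \in A); case: (_ \in A) => // /(_ isT).
Qed.

(** A directed cut that is minimal among those containing e is minimal among
    all non-empty cuts: let A0 be the initial set that defines it.  If the cut
    of B were a proper part of it, then A0 :&: B or A0 :|: B, or the same with
    the complement of B, would give a smaller directed cut through e. *)
Lemma dicocycle_of_initial D A e : initial D A -> e \in cut (underlying D) A ->
  exists C, [/\ dicocycle D C, e \in C & C \subset cut (underlying D) A].
Proof.
move=> iA eA; set cutD := cut (underlying D).
pose Q := [pred C : {set E} | (e \in C) &&
                              [exists A, (C == cutD A) && initial D A]].
have /minset_exists[C /minsetP[/andP[eC]]] : Q (cutD A).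
  by rewrite /= eA; apply/existsP; exists A; rewrite eqxx.
case/existsP=> A0 /andP[/eqP defC iA0] minC sCA; exists C; split=> //.
have minA0 B : initial D B -> e \in cutD B -> cutD B \subset C -> cutD B = C.
  move=> iB eB; apply: minC; rewrite /= eB.
  by apply/existsP; exists B; rewrite eqxx.
have inC f : f \in C = [&& f \in dedges D, src D f \in A0 & tgt D f \notin A0].
  by rewrite defC initial_cut.
have /initialP in0 := iA0.
have /and3P[eD e0 e1] : [&& e \in dedges D, src D e \in A0 & tgt D e \notin A0].
  by rewrite -inC.
(* Uncrossing inside A0: all tails are on the same side of B as that of e. *)
have capC B : cutD B \subset C -> src D e \in B ->
    {in C, forall f, src D f \in B}.
  move=> /subsetP sBC eB.
  have iI : initial D (A0 :&: B).
    apply/initialP=> f fD; rewrite !inE => /andP[f0 fB].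
    rewrite in0 //=; apply: contraTT f0 => nfB.
    have: f \in C by apply: sBC; rewrite mem_cut fD fB (negPf nfB).
    by rewrite inC => /and3P[].
  have <- : cutD (A0 :&: B) = C.
    apply: minA0 => //.
      by rewrite initial_cut // !inE eD e0 eB (negPf e1).
    apply/subsetP=> f; rewrite initial_cut // !inE => /and3P[fD /andP[f0 fB]].
    rewrite inC fD f0 /=; apply: contra => f1; rewrite f1 /=.
    apply: contraTT f1 => nfB.
    have: f \in C by apply: sBC; rewrite mem_cut fD fB (negPf nfB).
    by rewrite inC => /and3P[].
  by move=> f; rewrite initial_cut // !inE => /and3P[_ /andP[]].
(* Uncrossing outside A0: the same for the heads. *)
have cupC B : cutD B \subset C -> tgt D e \notin B ->
    {in C, forall f, tgt D f \notin B}.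
  move=> /subsetP sBC eB.
  have iU : initial D (A0 :|: B).
    apply/initialP=> f fD; rewrite !inE => /orP[/(in0 f fD)-> //| fB].
    apply/norP=> -[nf0 nfB].
    have: f \in C by apply: sBC; rewrite mem_cut fD fB (negPf nfB).
    by rewrite inC (negPf nf0) andbF.
  have <- : cutD (A0 :|: B) = C.
    apply: minA0 => //.
      by rewrite initial_cut // !inE eD e0 (negPf eB) (negPf e1).
    apply/subsetP=> f; rewrite initial_cut // !inE negb_or.
    case/and3P=> fD f0 /andP[nf1 nfB]; rewrite inC fD nf1 andbT /=.
    case/orP: f0 => // fB.
    have: f \in C by apply: sBC; rewrite mem_cut fD fB (negPf nfB).
    by rewrite inC => /and3P[].
  by move=> f; rewrite initial_cut // !inE negb_or => /and3P[_ _ /andP[]].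
have cutC B : cutD (~: B) = cutD B.
  by apply/setP=> f; rewrite !mem_cut !inE; do 3!case: (_ \in _).
have allC B : cutD B \subset C -> {in C, forall f,
    (src D f \in B) = (src D e \in B) /\ (tgt D f \in B) = (tgt D e \in B)}.
  move=> sBC f fC; have sBC' : cutD (~: B) \subset C by rewrite cutC.
  split.
    case: (boolP (src D e \in B)) => [/(capC B)-> // | nB].
    by apply/negbTE; have := capC _ sBC' _ f fC; rewrite !inE; apply.
  case: (boolP (tgt D e \in B)) => [eB | /(cupC B) nB].
    by have := cupC _ sBC' _ f fC; rewrite !inE !negbK; apply.
  exact/negbTE/nB.
apply/andP; split.
  apply/minsetP; split.
    apply/andP; split; first by apply/set0Pn; exists e.
    by apply/existsP; exists A0; apply/eqP.
  move=> X /andP[/set0Pn[f fX] /existsP[B /eqP defX]] sXC.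
  apply/eqP; rewrite eqEsubset sXC; apply/subsetP=> g gC.
  have fC := subsetP sXC f fX.
  have sBC : cutD B \subset C by rewrite /cutD -defX.
  move: fX; rewrite defX !mem_cut => /andP[_].
  have [-> ->] := allC B sBC f fC; have [-> ->] := allC B sBC g gC.
  by move: gC; rewrite inC => /and3P[->].
apply/existsP; exists A0; rewrite defC eqxx; apply/forallP=> f.
by apply/implyP; rewrite initial_cut // => /and3P[_ -> ->].
Qed.

(** The vertices that cannot be reached from the head of e form an initial set,
    which separates the tail of e from its head unless e is in the closure;
    conversely no walk that avoids going backwards through a directed cocycle
    can return to the side of its tails. *)
Lemma setD_cl_dicocycleP D S e : S \subset dedges D ->
  reflect (exists C, [/\ dicocycle D C, [disjoint C & S] & e \in C])
          (e \in dedges D :\: cl D (dedges D) S).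
Proof.
move=> sSD; rewrite !inE; apply: (iffP andP) => [[+ eD] | ].
  rewrite eD /= => nret.
  pose A := [set v | ~~ reach D (dedges D) S (tgt D e) v].
  have iA : initial D A.
    apply/initialP=> f fD; rewrite !inE; apply: contra => ef.
    exact: connect_trans ef (reach_fwd _ _ fD).
  have eA : e \in cut (underlying D) A.
    by rewrite initial_cut // !inE eD nret negbK /reach connect0.
  have [C [dC eC sCA]] := dicocycle_of_initial iA eA.
  exists C; split=> //; rewrite disjoint_subset; apply/subsetP=> f fC.
  have := subsetP sCA f fC; rewrite initial_cut // !inE negbK.
  case/and3P=> fD nf ef; apply: contra nf => fS.
  exact: connect_trans ef (reach_bwd _ _ fS).
case=> C [/andP[/minsetP[/andP[_ /existsP[B /eqP defB]] _]]].
case/existsP=> A /andP[/eqP defC /forall_inP dirC] disCS eC.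
have eD : e \in dedges D by move: eC; rewrite defB mem_cut => /andP[].
rewrite eD /=; split=> //; apply/negP.
have /andP[e0 e1] := dirC e eC.
have : forall u v, reach D (dedges D) S u v -> u \notin A -> v \notin A.
  move=> u v /connectP[q]; elim: q u => [|w q IHq] u /=; first by move=> _ ->.
  case/andP=> /stepP[f uw] wq def_v nuA; apply: (IHq w) => //.
  have fD : f \in dedges D by case: uw => -[] // /(subsetP sSD).
  apply/negP=> wA.
  have fC : f \in C.
    by rewrite defC mem_cut fD; case: uw => -[_ -> ->]; rewrite wA (negPf nuA).
  case: uw => -[fS def_u def_w].
    by have /andP[] := dirC f fC; rewrite def_u (negPf nuA).
  by rewrite (disjointFr disCS fC) in fS.
by move=> H /H; rewrite e0 => /(_ e1).
Qed.

(** * Minors *)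

Lemma joined_sym (G : graph V E) : symmetric (joined G).
Proof.
by move=> x y; apply: eq_existsb => e; congr (_ && _); rewrite andbC.
Qed.

Section Minor.
Variables (D : digraph V E) (X Y : {set E}).
Hypotheses (sXY : X \subset Y) (sYD : Y \subset dedges D).
Let M := dcontract (drestrict D Y) X.
Let r := contract_vertex (underlying (drestrict D Y)) X.

Lemma dedges_minor : dedges M = Y :\: X.
Proof. by rewrite /M /=; congr (_ :\: _); apply/setIidPr. Qed.

(** Components of the restriction to X are the classes of vertices that can be
    reached from each other when all edges of X are bidirected. *)
Lemma contract_vertex_eq x y : reflect (reach D X X x y) (r x == r y).
Proof.
have symJ : connect_sym (joined (restrict (underlying (drestrict D Y)) X)).
  exact/sym_connect_sym/joined_sym.
rewrite (root_connect symJ); apply: (iffP idP).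
  apply: connect_sub => {}x {}y /existsP[e]; rewrite !inE /=.
  case/andP=> [/andP[_ eX]] /andP[].
  case/orP=> /eqP-> /orP[] /eqP->; rewrite ?connect0 //.
    exact: reach_fwd.
  exact: reach_bwd.
apply: connect_sub => {}x {}y /stepP[e He]; apply: connect1.
have eX: e \in X by case: He => -[].
have eY := subsetP sXY e eX; have eD := subsetP sYD e eY.
apply/existsP; exists e; rewrite !inE /= eX eY eD /=.
by case: He => -[_ <- <-]; rewrite !eqxx ?orbT.
Qed.

Lemma reach_minor R S u v : X \subset R -> X \subset S ->
  reach M (R :\: X) (S :\: X) (r u) (r v) = reach D R S u v.
Proof.
move=> sXR sXS; have rX x y : r x = r y -> reach D R S x y.
  move/eqP/contract_vertex_eq; apply: reach_sub => //.
  exact: subset_trans sXS (subsetUr _ _).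
apply/idP/idP.
  case/connectP=> q; elim: q u => [|w q IHq] u /=; first by move=> _ /esym/rX.
  case/andP=> /stepP[e [[]|[]]]; rewrite !inE;
    move=> /andP[_ eRS] /esym/rX ue <- wq def_v.
    apply: connect_trans (connect_trans ue (reach_fwd D S eRS)) _.
    exact: IHq wq def_v.
  apply: connect_trans (connect_trans ue (reach_bwd D R eRS)) _.
  exact: IHq wq def_v.
case/connectP=> q; elim: q u => [|w q IHq] u /=.
  by move=> _ ->; apply: connect0.
case/andP=> /stepP[e He] wq /(IHq w wq){IHq wq}; apply: connect_trans.
case: (boolP (e \in X)) => [eX | neX].
  suff ->: r u = r w by apply: connect0.
  apply/eqP/contract_vertex_eq; case: He => -[_ <- <-].
    exact: reach_fwd.
  exact: reach_bwd.
apply/connect1/stepP; exists e; rewrite !inE neX.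
by case: He => -[eRS <- <-]; [left | right].
Qed.

(** With R equal to the edge set, minus p or not, and S equal to X, plus p or
    not, this covers all the closures that occur in the descriptions of bipolar
    and cyclic-bipolar minors. *)
Lemma cl_minor R S : X \subset R -> X \subset S ->
  cl M (R :\: X) (S :\: X) = cl D R S :\: X.
Proof.
by move=> sXR sXS; apply/setP=> e; rewrite !inE reach_minor // andbA.
Qed.

End Minor.

End EdgeClosure.


(** * Bipolar and cyclic-bipolar digraphs *)

Section Bipolar.
Variables V E : finType.
Implicit Types (D : digraph V E) (R S X Y : {set E}) (G : graph V E).

Lemma mem_verts D v :
  reflect (exists2 e, e \in dedges D & v = src D e \/ v = tgt D e)
          (v \in verts (underlying D)).
Proof.
apply: (iffP bigcupP) => -[e eD He]; exists e => //.
  by case/set2P: He; [left | right].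
by apply/set2P.
Qed.

Lemma step0P D R x y :
  reflect (exists e, [/\ e \in R, src D e = x & tgt D e = y])
          (step D R set0 x y).
Proof.
apply: (iffP (stepP _ _ _ _ _)) => -[e]; last by exists e; left.
by case=> [?|[]]; [exists e | rewrite inE].
Qed.

Lemma cl0_eq0P D R : reflect
  {in R, forall e, ~~ reach D R set0 (tgt D e) (src D e)} (cl D R set0 == set0).
Proof.
apply: (iffP eqP) => [cl0 e eR | acR].
  apply/negP=> e_ret; suff : e \in cl D R set0 by rewrite cl0 inE.
  by rewrite inE eR.
by apply/setP=> e; rewrite !inE; apply/andP=> -[/acR/negP].
Qed.

(** Two distinct vertices that reach each other would put the first edge of a
    walk between them on a directed cycle. *)
Lemma reach_antisym D R u v : cl D R set0 = set0 ->
  reach D R set0 u v -> reach D R set0 v u -> u = v.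
Proof.
move/eqP/cl0_eq0P=> acR.
case/connectP=> [[|w q] //= /andP[/step0P[e [eR <- <-]] wq def_v]] vu.
case/negP: (acR e eR); apply: connect_trans vu.
by apply/connectP; exists q.
Qed.

Lemma reach_setU1 D R S p u v : reach D R (p |: S) u v ->
  reach D R S u v \/ reach D R S u (tgt D p) /\ reach D R S (src D p) v.
Proof.
apply: connect_add_arc => x y /stepP[e []] [].
  by left; apply/stepP; exists e; left.
case/setU1P=> [-> <- <- | eS]; first by right.
by left; apply/stepP; exists e; right.
Qed.

Lemma reach_setD1 D R S p u v : reach D R S u v ->
  reach D (R :\ p) S u v \/
  reach D (R :\ p) S u (src D p) /\ reach D (R :\ p) S (tgt D p) v.
Proof.
apply: connect_add_arc => x y /stepP[e []] []; last first.
  by left; apply/stepP; exists e; right.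
have [-> _ <- <- | ne_p eR] := eqVneq e p; first by right.
by left; apply/stepP; exists e; left; rewrite !inE ne_p.
Qed.

Lemma acyclicP D : acyclic D <-> cl D (dedges D) set0 = set0.
Proof.
split=> [acD | cl0 C].
  apply/setP=> e; rewrite [RHS]inE; apply/negbTE/(cl0_dicycleP _ (subxx _)).
  by case=> C [dC _ _]; case/negP: (acD C).
apply/negP=> dC; have [e eC] := dicycle_neq0 dC.
suff : e \in cl D (dedges D) set0 by rewrite cl0 inE.
by apply/cl0_dicycleP=> //; exists C; split=> //; apply: dicycle_sub.
Qed.

(** As no edge is on a directed cycle, the walk that returns from the head of
    an edge to its tail has to go backwards through p. *)
Lemma bipolar_poles D p : cl D (dedges D) set0 = set0 ->
    cl D (dedges D) [set p] = dedges D ->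
  {in verts (underlying D), forall v,
    reach D (dedges D) set0 (src D p) v /\ reach D (dedges D) set0 v (tgt D p)}.
Proof.
move=> /eqP/cl0_eq0P acD clp.
have ret e : e \in dedges D -> reach D (dedges D) set0 (tgt D e) (tgt D p) /\
                               reach D (dedges D) set0 (src D p) (src D e).
  move=> eD; have: e \in cl D (dedges D) [set p] by rewrite clp.
  rewrite inE eD -[[set p]]setU0 => /reach_setU1[|//].
  by rewrite (negPf (acD e eD)).
move=> v /mem_verts[e eD def_v]; have [et se] := ret e eD.
have ee := reach_fwd D set0 eD.
case: def_v => ->; split=> //; first exact: connect_trans ee et.
exact: connect_trans se ee.
Qed.

Lemma bipolarP D p : bipolar D p <->
  [/\ p \in dedges D, cl D (dedges D) set0 = set0
    & cl D (dedges D) [set p] = dedges D].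
Proof.
set A := dedges D.
split=> [[pD /acyclicP acD [s [t [def_s def_t def_st]]]] | [pD acD clp]].
  split=> //; have /eqP/cl0_eq0P nret := acD.
  have [s_src t_snk] : s \in sources D /\ t \in sinks D.
    by rewrite def_s def_t !inE !eqxx.
  have srcD e : e \in A -> tgt D e != s.
    by move=> eD; move: s_src; rewrite inE => /andP[_ /forall_inP->].
  have snkD e : e \in A -> src D e != t.
    by move=> eD; move: t_snk; rewrite inE => /andP[_ /forall_inP->].
  have def_sp : src D p = s.
    have : src D p \in [set s; t] by rewrite -def_st !inE eqxx.
    by rewrite !inE (negPf (snkD p pD)) orbF => /eqP.
  have def_tp : tgt D p = t.
    have : tgt D p \in [set s; t] by rewrite -def_st !inE eqxx orbT.
    by rewrite !inE (negPf (srcD p pD)) => /eqP.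
  have reach_verts u v : reach D A set0 u v -> u = v \/
      u \in verts (underlying D) /\ v \in verts (underlying D).
    case/connectP=> q; elim: q u => [|w q IHq] u /=; first by left.
    case/andP=> /step0P[e [eD <- <-]] /IHq{}IHq /IHq{IHq} wv; right.
    split; first by apply/mem_verts; exists e; auto.
    by case: wv => [<- | []//]; apply/mem_verts; exists e; auto.
  (* A source component that is not reduced to a source would contain a
     directed cycle; the only source is s. *)
  have from_s v : v \in verts (underlying D) -> reach D A set0 s v.
    move=> vD; have [w [wv minw]] := connect_minimal (step D A set0) v.
    suff : w \in sources D by rewrite def_s inE => /eqP <-.
    rewrite inE; apply/andP; split.
      by case: (reach_verts w v wv) => [->|[]].
    apply/forall_inP=> e eD; apply/eqP=> def_w; case/negP: (nret e eD).
    rewrite def_w; apply: minw; rewrite -def_w; exact: reach_fwd.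
  have to_t v : v \in verts (underlying D) -> reach D A set0 v t.
    move=> vD; have [w [vw maxw]] := connect_maximal (step D A set0) v.
    suff : w \in sinks D by rewrite def_t inE => /eqP <-.
    rewrite inE; apply/andP; split.
      by case: (reach_verts v w vw) => [<-|[]].
    apply/forall_inP=> e eD; apply/eqP=> def_w; case/negP: (nret e eD).
    rewrite def_w; apply: maxw; rewrite -def_w; exact: reach_fwd.
  apply/setP=> e; rewrite inE; case eD: (e \in A) => //=.
  have te : reach D A set0 (tgt D e) t by apply/to_t/mem_verts; exists e; auto.
  have se : reach D A set0 s (src D e).
    by apply/from_s/mem_verts; exists e; auto.
  have sub : subrel (reach D A set0) (reach D A [set p]).
    by apply: reach_sub; rewrite ?sub0set.
  apply: connect_trans (sub _ _ te) (connect_trans _ (sub _ _ se)).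
  by rewrite -def_tp -def_sp; apply: reach_bwd; rewrite inE.
have poles := bipolar_poles acD clp; have /eqP/cl0_eq0P nret := acD.
split=> //; first exact/acyclicP.
have pvert : src D p \in verts (underlying D) /\
             tgt D p \in verts (underlying D).
  by split; apply/mem_verts; exists p; auto.
exists (src D p), (tgt D p); split=> //; apply/eqP; rewrite eqEsubset sub1set.
  apply/andP; split.
    apply/subsetP=> v; rewrite !inE => /andP[vD /forall_inP srcv].
    have [sv _] := poles v vD.
    rewrite eq_sym; apply/eqP/(connect_to_source _ sv).
    by move=> x; apply/step0P=> -[e [eD _ def_v]]; case/eqP: (srcv e eD).
  rewrite inE pvert.1; apply/forall_inP=> e eD; apply/eqP=> def_s.
  case/negP: (nret e eD); rewrite def_s; apply: (poles _ _).1.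
  by apply/mem_verts; exists e; auto.
apply/andP; split.
  apply/subsetP=> v; rewrite !inE => /andP[vD /forall_inP snkv].
  have [_ vt] := poles v vD; apply/eqP/(connect_from_sink _ vt).
  by move=> x; apply/step0P=> -[e [eD def_v _]]; case/eqP: (snkv e eD).
rewrite inE pvert.2; apply/forall_inP=> e eD; apply/eqP=> def_t.
case/negP: (nret e eD); rewrite def_t; apply: (poles _ _).2.
by apply/mem_verts; exists e; auto.
Qed.

Lemma cyclic_bipolarP D p : cyclic_bipolar D p <->
  [/\ p \in dedges D, cl D (dedges D) set0 = dedges D
    & cl D (dedges D :\ p) set0 = set0].
Proof.
split=> [[pD cycD allp] | [pD cycD acDp]]; split=> //.
- apply/eqP; rewrite eqEsubset cl_sub; apply/subsetP=> e eD.
  have [C dC eC] := cycD e eD.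
  by apply/cl0_dicycleP=> //; exists C; split=> //; apply: dicycle_sub.
- apply/setP=> e; rewrite [RHS]inE.
  apply/negbTE/(cl0_dicycleP _ (subsetDl _ _)).
  by case=> C [/allp pC /subsetP/(_ p pC)]; rewrite !inE eqxx.
- move=> e; rewrite -{1}cycD => /(cl0_dicycleP _ (subxx _))[C [dC _ eC]].
  by exists C.
move=> C dC; have [e eC] := dicycle_neq0 dC; apply: contraT => npC.
suff : e \in cl D (dedges D :\ p) set0 by rewrite acDp inE.
apply/cl0_dicycleP; first exact: subsetDl.
by exists C; split=> //; rewrite subsetD1 dicycle_sub.
Qed.

Lemma joined_verts G u v : joined G u v -> u \in verts G /\ v \in verts G.
Proof.
by case/existsP=> e /and3P[eG ue ve]; split; apply/bigcupP; exists e.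
Qed.

(** The argument by st-orderings: after removal of a vertex w, a vertex x can
    still follow its path to t or trace back its path from s, since w cannot be
    on both without creating a cycle; and s and t are adjacent. *)
Lemma st_two_connected G (r : rel V) s t :
    subrel r (joined G) -> antisymmetric (connect r) ->
    joined G s t -> s != t ->
    {in verts G, forall v, connect r s v /\ connect r v t} ->
  two_connected G.
Proof.
move=> rG anti_r st neq_st poles; have [sG tG] := joined_verts st.
have symJ : connect_sym (joined G) by apply/sym_connect_sym/joined_sym.
have subG u v : connect r u v -> connect (joined G) u v.
  by apply: connect_sub => x y /rG/connect1.
split=> [|u v uG vG|w wG u v].
- by rewrite (cardD1 s) sG (cardD1 t) !inE eq_sym neq_st tG.
- have [su _] := poles u uG; have [sv _] := poles v vG.
  by apply: connect_trans (subG _ _ sv); rewrite symJ subG.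
set Jw : rel V := fun x y => _.
have symJw : connect_sym Jw.
  apply/sym_connect_sym=> x y.
  by rewrite /Jw joined_sym; do 2!case: (_ != w).
have avoid x y : connect r x y -> ~~ (connect r x w && connect r w y) ->
    connect Jw x y.
  case/connectP=> q; elim: q x => [|z q IHq] x /=; first by move=> _ ->.
  case/andP=> xz zq def_y nw.
  have zy : connect r z y by apply/connectP; exists q.
  have zw : ~~ (connect r z w && connect r w y).
    by apply: contra nw => /andP[/(connect_trans (connect1 xz))-> ->].
  apply: connect_trans (IHq z zq def_y zw); apply: connect1.
  apply/and3P; split; last exact: rG.
    apply: contraNneq nw => <-; rewrite connect0.
    exact: connect_trans (connect1 xz) zy.
  by apply: contraNneq zw => <-; rewrite connect0.
have pole x : x \in verts G :\ w -> exists y,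
    [/\ y \in [set s; t], y != w & connect Jw x y].
  case/setD1P=> xw xG; have [sx xt] := poles x xG.
  have [sw wt] := poles w wG.
  case: (boolP (connect r w x)) => [wx | nwx].
    have nxw : ~~ connect r x w.
      by apply: contra xw => xw; apply/eqP/anti_r; rewrite xw.
    exists t; rewrite !inE eqxx orbT; split=> //.
      by apply: contraNneq nxw => <-.
    by apply: avoid; rewrite // negb_and nxw.
  exists s; rewrite !inE eqxx; split=> //.
    by apply: contraNneq nwx => <-.
  by rewrite symJw; apply: avoid; rewrite // negb_and nwx orbT.
case/pole=> y [y_st yw uy] /pole[z [z_st zw vz]].
apply: connect_trans uy _; rewrite symJw; apply: connect_trans vz _.
have [-> | neq_zy] := eqVneq z y; first exact: connect0.
apply: connect1; rewrite /Jw zw yw /=.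
case/set2P: z_st neq_zy => ->; case/set2P: y_st => ->; rewrite ?eqxx // => _.
by rewrite joined_sym.
Qed.

Section Orientation.
Variables (G : graph V E) (D : digraph V E).
Hypothesis oGD : orientation G D.

Lemma orientation_verts : verts G = verts (underlying D).
Proof.
by case: oGD => eD endsG; apply: eq_big => [e|e /endsG]; rewrite /= ?eD.
Qed.

Lemma orientation_joined R : R \subset dedges D ->
  subrel (step D R set0) (joined G).
Proof.
case: oGD => eD endsG /subsetP sRD x y /step0P[e [/sRD]]; rewrite eD.
move=> eG <- <-.
by apply/existsP; exists e; rewrite eG endsG // !inE !eqxx ?orbT.
Qed.

Lemma orientation_card_ends e : e \in edges G ->
  #|ends G e| = (src D e != tgt D e).+1.
Proof. by case: oGD => _ endsG /endsG->; rewrite cards2. Qed.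

End Orientation.

(** By [bipolarP] and [cl_minor]: the closures of the empty set and of p in the
    minor are those of X and of p + X in Y, with X removed. *)
Lemma bipolar_minor D X Y p : X \subset Y -> Y \subset dedges D ->
  bipolar (dcontract (drestrict D Y) X) p <->
  [/\ p \in Y :\: X, cl D Y X = X & cl D Y (p |: X) = Y].
Proof.
move=> sXY sYD; set M := dcontract _ _.
have [defM clM] := (dedges_minor X sYD, cl_minor sXY sYD).
apply: (iff_trans (bipolarP _ _)); rewrite defM.
have -> : cl M (Y :\: X) set0 = cl D Y X :\: X.
  by rewrite -clM //; congr (cl _ _ _); rewrite setDv.
have clp : p \in Y :\: X -> cl M (Y :\: X) [set p] = cl D Y (p |: X) :\: X.
  move=> /setDP[pY nX]; rewrite -clM ?subsetUr //; congr (cl _ _ _).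
  by rewrite setDUl setDv setU0; apply/esym/setDidPl; rewrite disjoints1.
have sXp : p \in Y :\: X -> X \subset cl D Y (p |: X).
  case/setDP=> pY _; apply: subset_trans (subsetUr [set p] X) (sub_cl _ _).
  by rewrite subUset sub1set pY.
split=> -[pYX]; rewrite clp // => defX defY; split=> //.
- by apply/eqP; rewrite eqEsubset sub_cl // andbT -setD_eq0 defX.
- apply/eqP; rewrite eqEsubset cl_sub /= -(setUidPr (sXp pYX)) -subDset.
  by rewrite -defY subsetDl.
- by rewrite defX setDv.
by rewrite defY.
Qed.

(** By [cyclic_bipolarP] and [cl_minor]; deletion of p and contraction of X
    commute as p is outside X. *)
Lemma cyclic_bipolar_minor D X Y p : X \subset Y -> Y \subset dedges D ->
  cyclic_bipolar (dcontract (drestrict D Y) X) p <->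
  [/\ p \in Y :\: X, cl D Y X = Y & cl D (Y :\ p) X = X].
Proof.
move=> sXY sYD; set M := dcontract _ _.
have [defM clM] := (dedges_minor X sYD, cl_minor sXY sYD).
apply: (iff_trans (cyclic_bipolarP _ _)); rewrite defM.
have -> : cl M (Y :\: X) set0 = cl D Y X :\: X.
  by rewrite -clM //; congr (cl _ _ _); rewrite setDv.
have sXYp : p \in Y :\: X -> X \subset Y :\ p.
  by case/setDP=> _ npX; rewrite subsetD1 sXY.
have clp : p \in Y :\: X ->
    cl M ((Y :\: X) :\ p) set0 = cl D (Y :\ p) X :\: X.
  move=> pYX; rewrite -clM ?sXYp //; congr (cl _ _ _); last by rewrite setDv.
  by rewrite !setDDl setUC.
split=> -[pYX]; rewrite clp // => defY defX; split=> //.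
- apply/eqP; rewrite eqEsubset cl_sub /=.
  by rewrite -(setUidPr (sub_cl D sXY)) -subDset -defY subsetDl.
- by apply/eqP; rewrite eqEsubset sub_cl ?sXYp // andbT -setD_eq0 defX.
- by rewrite defY.
by rewrite defX setDv.
Qed.

Lemma orientation_minor G D X Y : orientation G D ->
  orientation (contract (restrict G Y) X) (dcontract (drestrict D Y) X).
Proof.
case=> eD endsG; split=> [|e /=]; first by rewrite /= eD.
case/setDP=> /setIP[eG _] _; rewrite endsG // imsetU1 imset_set1.
have eq_r : contract_vertex (restrict G Y) X =1
            contract_vertex (underlying (drestrict D Y)) X.
  apply: eq_root => x y; apply: eq_existsb => f /=; rewrite !in_setI eD.
  by case fG: (f \in edges G) => //=; rewrite endsG.
by rewrite /= !eq_r.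
Qed.

End Bipolar.

(** * Bipolarity forces 2-connectedness *)

Section Blocks.
Context (d : Order.disp_t) (V : finType) (E : finOrderType d).
Variables (G : graph V E) (D : digraph V E).
Hypothesis oGD : orientation G D.

Lemma bipolar_block p : bipolar D p -> block G \/ single_isthmus G.
Proof.
case/bipolarP=> pD acD clp; have [eD endsG] := oGD.
have /eqP/cl0_eq0P nret := acD.
have noloop e : e \in dedges D -> src D e != tgt D e.
  by move=> eD'; apply: contraNneq (nret e eD') => ->; apply: connect0.
have [sp | gt1] := leqP #|edges G| 1; [right | left; split=> //].
  exists p; last by rewrite (orientation_card_ends oGD) -?eD // noloop.
  by apply/eqP; rewrite eq_sym eqEcard sub1set -{1}eD pD cards1.
- by move=> e eG; rewrite (orientation_card_ends oGD) // noloop // eD.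
apply: (@st_two_connected _ _ _ (step D (dedges D) set0) (src D p) (tgt D p)).
- exact: orientation_joined.
- by move=> u v /andP[uv vu]; apply: reach_antisym acD uv vu.
- by apply: (orientation_joined oGD (subxx _)); apply/step0P; exists p.
- exact: noloop.
by rewrite (orientation_verts oGD); apply: bipolar_poles.
Qed.

(** Deletion of p leaves an acyclic digraph, in which every vertex is on a path
    from the head of p to its tail.  As soon as there is a second edge, p is no
    loop, and head and tail can serve as source and sink. *)
Lemma cyclic_bipolar_block p : cyclic_bipolar D p -> block G \/ single_loop G.
Proof.
case/cyclic_bipolarP=> pD cycD acDp; have [eD endsG] := oGD.
have ret e : e \in dedges D -> reach D (dedges D) set0 (tgt D e) (src D e).
  by rewrite -{1}cycD inE => /andP[].
have /eqP/cl0_eq0P nret := acDp.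
set r := reach D (dedges D :\ p) set0.
have loop e : e \in dedges D -> e != p -> src D e != tgt D e.
  move=> eD' ep; apply: contraNneq (nret e _) => [->|]; first exact: connect0.
  by rewrite !inE ep.
have retp : r (tgt D p) (src D p).
  by case: (reach_setD1 p (ret p pD)) => // -[].
have rete e : e \in dedges D -> e != p ->
    r (tgt D e) (src D p) /\ r (tgt D p) (src D e).
  move=> eD' ep; case: (reach_setD1 p (ret e eD')) => // e_ret.
  by case/idPn: e_ret; apply: nret; rewrite !inE ep.
have [sp | gt1] := leqP #|edges G| 1; [right | left].
  have defG : edges G = [set p].
    by apply/eqP; rewrite eq_sym eqEcard sub1set -{1}eD pD cards1.
  exists p => //; rewrite (orientation_card_ends oGD) -?eD //.
  suff -> : src D p = tgt D p by rewrite eqxx.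
  symmetry; apply: connect_from_sink retp => x; apply/step0P=> -[e []].
  by rewrite eD defG !inE andNb.
have [e /setD1P[ep eD']]: exists e, e \in dedges D :\ p.
  by apply/card_gt0P; move: gt1; rewrite -eD (cardsD1 p) pD.
have loopp : src D p != tgt D p.
  apply/negP=> /eqP loopp; have [te se] := rete e eD' ep.
  suff e_ret : r (tgt D e) (src D e).
    by case/idPn: e_ret; apply: nret; rewrite !inE ep.
  by apply: connect_trans te _; rewrite loopp.
have noloop f : f \in dedges D -> src D f != tgt D f.
  by have [-> | fp /loop->] := eqVneq f p.
split.
- by move=> f fG; rewrite (orientation_card_ends oGD) // noloop // eD.
- set r' := step D (dedges D :\ p) set0.
  apply: (@st_two_connected _ _ _ r' (tgt D p) (src D p)).
  + exact: (orientation_joined oGD (subsetDl _ _)).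
  + by move=> u v /andP[uv vu]; apply: reach_antisym acDp uv vu.
  + rewrite joined_sym; apply: (orientation_joined oGD (subxx _)).
    by apply/step0P; exists p.
  + by rewrite eq_sym.
  rewrite (orientation_verts oGD) => v /mem_verts[f fD].
  have [-> | fp] := eqVneq f p.
    by case=> ->; split=> //; apply: connect0.
  have [tf sf] := rete f fD fp.
  have ff : r (src D f) (tgt D f) by apply: reach_fwd; rewrite !inE fp.
  case=> ->; split=> //; first exact: connect_trans ff tf.
  exact: connect_trans sf ff.
- exact: gt1.
Qed.

End Blocks.

(** * Flags of a closure operator on a linearly ordered set *)

Section Flags.
Context (d : Order.disp_t) (E : finOrderType d).
Implicit Types (S T : {set E}) (s : seq {set E}).

Lemma is_min_uniq S a b : is_min S a -> is_min S b -> a = b.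
Proof.
move=> /andP[aS /forall_inP lea] /andP[bS /forall_inP leb].
by apply/le_anti; rewrite lea ?leb.
Qed.

Lemma min_geP S a x0 : x0 \in S ->
  reflect {in S, forall x, (a <= x)%O} (min_ge S a).
Proof.
move=> x0S; apply: (iffP existsP) => [[m /andP[]] | leS].
  case/andP=> mS /forall_inP lem am x xS.
  exact: le_trans am (lem x xS).
have [m mS lem] := arg_minP id x0S.
exists m; rewrite leS // andbT; apply/andP; split=> //.
by apply/forall_inP=> x /lem.
Qed.

Section Closure.
Variables (A : {set E}) (c : {set E} -> {set E}).

(** What remains of the description of the filtration of an orientation when
    only the closure operator is kept: p is the edge w.r.t. which the k-th minor
    has to be bipolar or cyclic-bipolar. *)
Record is_flag s : Prop := IsFlag {
  flag_nonempty : 0 < size s;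
  flag_bot : nth set0 s 0 = c set0;
  flag_top : nth set0 s (size s).-1 = A;
  flag_step : forall k, 1 <= k <= (size s).-1 ->
    exists2 p, is_min (nth set0 s k :\: nth set0 s k.-1) p
             & nth set0 s k = c (p |: nth set0 s k.-1);
  flag_min : forall j k a b, 1 <= j < k -> k <= (size s).-1 ->
    is_min (nth set0 s j :\: nth set0 s j.-1) a ->
    is_min (nth set0 s k :\: nth set0 s k.-1) b -> (a < b)%O }.

Definition below a : {set E} := [set x in A | (x < a)%O].

(** The elements kept by the greedy algorithm: for a matroid closure they form
    the lexicographically least basis. *)
Definition actives : {set E} := [set a in A | a \notin c (below a)].

Definition active_flag : seq {set E} :=
  rcons [seq c (below a) | a <- increasing actives] A.

Record is_closure : Prop := IsClosure {
  closure_sub : forall S, c S \subset A;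
  closure_ext : forall S, S \subset A -> S \subset c S;
  closure_mono : forall S T, S \subset T -> c S \subset c T;
  closure_idem : forall S, S \subset A -> c (c S) = c S }.

Hypothesis clA : is_closure.

Lemma closure_min S T : T \subset A -> S \subset c T -> c S \subset c T.
Proof. by move=> sT sS; rewrite -(closure_idem clA sT) (closure_mono clA). Qed.

Lemma closure_setU1 p S : p \in A -> S \subset A -> c (p |: c S) = c (p |: S).
Proof.
move=> pA sS; have sU : p |: S \subset A by rewrite subUset sub1set pA.
have ext := closure_ext clA; apply/eqP; rewrite eqEsubset; apply/andP; split.
  apply: closure_min => //.
  rewrite subUset (closure_mono clA) ?subsetUr // andbT.
  by apply: subset_trans (ext _ sU); rewrite subsetUl.
by rewrite (closure_mono clA) // setUS ?ext.
Qed.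


Section IsFlag.
Variable s : seq {set E}.
Hypothesis fs : is_flag s.
Local Notation u k := (nth set0 s k).

Lemma flag_next k : k.+1 < size s ->
  exists2 p, is_min ((u k.+1) :\: (u k)) p & (u k.+1) = c (p |: (u k)).
Proof.
move=> lt_k; apply: (flag_step fs (k := k.+1)).
by rewrite /= -ltnS prednK ?(flag_nonempty fs).
Qed.

Lemma flag_closed k : k < size s -> (u k) \subset A /\ c (u k) = (u k).
Proof.
elim: k => [|k IHk] lt_k.
  by rewrite (flag_bot fs) closure_sub ?closure_idem ?sub0set.
have [sA _] := IHk (ltnW lt_k).
have [p /andP[/setDP[pk _] _] def_k] := flag_next lt_k.
have sub1 : p \in A by apply: subsetP pk; rewrite def_k closure_sub.
by rewrite def_k closure_sub ?closure_idem // subUset sub1set sub1.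
Qed.

Lemma flag_proper k : k.+1 < size s -> (u k) \proper (u k.+1).
Proof.
move=> lt_k; have [p /andP[/setDP[pk npk] _] def_k] := flag_next lt_k.
apply/properP; split; last by exists p.
have [sA _] := flag_closed (ltnW lt_k); have [sA' _] := flag_closed lt_k.
rewrite def_k; apply: subset_trans (closure_ext clA _); first exact: subsetUr.
by rewrite subUset sub1set sA (subsetP sA').
Qed.

Lemma flag_mono j k : j <= k -> k < size s -> (u j) \subset (u k).
Proof.
elim: k => [|k IHk]; first by rewrite leqn0 => /eqP->.
rewrite leq_eqVlt => /predU1P[-> // | le_jk] lt_k.
exact: subset_trans (IHk le_jk (ltnW lt_k)) (proper_sub (flag_proper lt_k)).
Qed.

(** An element of A outside the k-th term is added at some later step, hence
    is at least as large as the least element added there, and this one is at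
    least as large as p because the minima increase. *)
Lemma flag_next_min k p : k.+1 < size s ->
  is_min ((u k.+1) :\: (u k)) p -> is_min (A :\: (u k)) p.
Proof.
move=> lt_k min_p; have s_gt0 := flag_nonempty fs.
have [sA _] := flag_closed lt_k.
have /andP[/setDP[pk npk] _] := min_p.
apply/andP; split; first by rewrite !inE npk (subsetP sA).
apply/forall_inP=> y /setDP[yA nyk].
have ex_j : exists j, y \in (u j) by exists (size s).-1; rewrite (flag_top fs).
case: (ex_minnP ex_j) => -[|j] yj minj.
  by case/negP: nyk; apply: (subsetP (flag_mono (leq0n _) (ltnW lt_k))).
have lt_js : j.+1 < size s.
  by rewrite -(prednK s_gt0) ltnS minj ?(flag_top fs).
have nyj : y \notin (u j) by apply/negP=> /minj; rewrite ltnn.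
have le_kj : k <= j.
  rewrite leqNgt; apply: contra nyk => lt_jk.
  exact: (subsetP (flag_mono lt_jk (ltnW lt_k))).
have [q min_q _] := flag_next lt_js.
have le_qy : (q <= y)%O.
  by case/andP: min_q => _ /forall_inP->; rewrite ?inE ?nyj.
move: le_kj; rewrite leq_eqVlt => /predU1P[def_k | lt_kj].
  by rewrite def_k in min_p; rewrite (is_min_uniq min_p min_q).
apply/ltW/(lt_le_trans _ le_qy).
apply: (flag_min fs (j := k.+1) (k := j.+1)) => //.
by rewrite -ltnS prednK.
Qed.

End IsFlag.

(** By [flag_next_min], each term of a flag is determined by the previous one,
    and a flag cannot stop before it reaches A nor continue after that. *)
Lemma flag_uniq s t : is_flag s -> is_flag t -> s = t.
Proof.
have eq_nth s1 s2 k : is_flag s1 -> is_flag s2 -> k < size s1 -> k < size s2 ->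
    nth set0 s1 k = nth set0 s2 k.
  move=> f1 f2; elim: k => [|k IHk] lt1 lt2; first by rewrite !flag_bot.
  have [p minp ->] := flag_next f1 lt1; have [q minq ->] := flag_next f2 lt2.
  move: (flag_next_min f1 lt1 minp) (flag_next_min f2 lt2 minq).
  by rewrite IHk ?(ltnW lt1) ?(ltnW lt2) // => /is_min_uniq H /H->.
have le_size s1 s2 : is_flag s1 -> is_flag s2 -> size s2 <= size s1.
  move=> f1 f2; rewrite leqNgt; apply/negP=> lt12.
  have s1_gt0 := flag_nonempty f1.
  have /flag_proper : (size s1).-1.+1 < size s2 by rewrite prednK.
  move/(_ f2)/properP=> [_ [x x2]].
  rewrite -(eq_nth s1) ?prednK // ?(ltnW lt12) // ?(flag_top f1).
  case/negP; apply: subsetP x2; rewrite prednK //.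
  by case: (flag_closed f2 lt12).
move=> fs ft.
have eq_size : size s = size t by apply/anti_leq; rewrite !le_size.
by apply: (@eq_from_nth _ set0) => // k lt_k; apply: eq_nth; rewrite -?eq_size.
Qed.

(** By induction on x: an element that is not active is in the closure of the
    smaller ones, hence of the active elements below these. *)
Lemma mem_closure_actives x : x \in A ->
  x \in c [set a in actives | (a <= x)%O].
Proof.
have [n] := ubnP #|below x|; elim: n x => // n IHn x /ltnSE le_n xA.
have sA (P : pred E) : [set a in actives | P a] \subset A.
  by apply/subsetP=> y; rewrite !inE => /andP[/andP[]].
have [x_act | x_in] := boolP (x \in actives).
  by apply: (subsetP (closure_ext clA (sA _))); rewrite inE x_act /=.
rewrite inE xA negbK in x_in; apply: subsetP x_in; apply: closure_min => //.
apply/subsetP=> y; rewrite inE => /andP[yA lt_yx].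
apply: (subsetP (closure_mono clA _)) (IHn y _ yA).
  apply/subsetP=> z; rewrite !inE => /andP[-> /le_lt_trans lt_zx] /=.
  exact/ltW/lt_zx.
apply: leq_trans le_n; apply: proper_card; apply/properP; split.
  apply/subsetP=> z; rewrite !inE => /andP[-> /lt_trans] /=.
  exact.
by exists y; rewrite inE yA ?lt_yx ?ltxx.
Qed.

Lemma closure_below a : c (below a) = c [set x in actives | (x < a)%O].
Proof.
apply/eqP; rewrite eqEsubset; apply/andP; split; last first.
  apply: (closure_mono clA); apply/subsetP=> x; rewrite !inE.
  by case/andP=> /andP[-> _] ->.
apply: closure_min.
  by apply/subsetP=> x; rewrite !inE => /andP[/andP[-> _] _].
apply/subsetP=> x; rewrite inE => /andP[xA lt_xa].
apply: (subsetP (closure_mono clA _)) (mem_closure_actives xA).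
apply/subsetP=> z; rewrite !inE => /andP[-> /le_lt_trans] /=.
exact.
Qed.

Lemma closure_actives : c actives = A.
Proof.
apply/eqP; rewrite eqEsubset closure_sub //.
apply/subsetP=> x /mem_closure_actives.
apply: subsetP; apply: (closure_mono clA).
by apply/subsetP=> z; rewrite inE => /andP[].
Qed.

Let acts := increasing actives.

Lemma size_active_flag : size active_flag = (size acts).+1.
Proof. by rewrite size_rcons size_map. Qed.

Lemma nth_active_flag a0 k : k < size acts ->
  nth set0 active_flag k = c (below (nth a0 acts k)).
Proof. by move=> lt_k; rewrite nth_rcons size_map lt_k (nth_map a0). Qed.

Lemma acts_sorted : sorted <%O acts.
Proof.
rewrite lt_sorted_uniq_le sort_uniq enum_uniq.
exact: sort_le_sorted.
Qed.

Lemma mem_acts a : (a \in acts) = (a \in actives).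
Proof. by rewrite mem_sort mem_enum. Qed.

Lemma mem_take_acts a0 k x : k < size acts ->
  (x \in take k acts) = (x \in actives) && (x < nth a0 acts k)%O.
Proof.
move=> lt_k; rewrite -mem_acts.
have [x_acts | nx] := boolP (x \in acts); last first.
  by apply: contraNF nx => /mem_take.
rewrite in_take // -{2}(nth_index a0 x_acts).
by rewrite (lt_sorted_ltn_nth a0 acts_sorted) ?inE ?index_mem.
Qed.

(** The k-th term is spanned by the first k active elements, including the last
    term A, for which there is no further active element. *)
Lemma active_flag_take k : k <= size acts ->
  nth set0 active_flag k = c [set a in take k acts].
Proof.
rewrite leq_eqVlt => /predU1P[-> | lt_k].
  rewrite take_size nth_rcons size_map ltnn eqxx -closure_actives.
  by congr c; apply/setP=> a; rewrite inE mem_acts.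
have a0 : E by case: (acts) lt_k.
rewrite (nth_active_flag a0) // closure_below; congr c; apply/setP=> x.
by rewrite [RHS]inE (mem_take_acts a0) // inE.
Qed.

Lemma active_flag_step_min a0 k : k < size acts ->
  is_min (nth set0 active_flag k.+1 :\: nth set0 active_flag k) (nth a0 acts k).
Proof.
move=> lt_k; set a := nth a0 acts k.
have : a \in actives by rewrite -mem_acts mem_nth.
rewrite inE => /andP[aA na]; have sA j : [set a in take j acts] \subset A.
  apply/subsetP=> x; rewrite inE => /mem_take.
  by rewrite mem_acts inE => /andP[].
apply/andP; split.
  rewrite inE (nth_active_flag a0) // na active_flag_take //.
  apply: (subsetP (closure_ext clA (sA _))).
  by rewrite inE (take_nth a0) // mem_rcons inE eqxx.
apply/forall_inP=> x /setDP[xk]; rewrite (nth_active_flag a0) // => nx.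
rewrite leNgt; apply: contra nx => lt_xa.
apply: (subsetP (closure_ext clA _)).
  by apply/subsetP=> y; rewrite inE => /andP[].
rewrite inE lt_xa andbT; apply: subsetP xk.
by rewrite active_flag_take // closure_sub.
Qed.

Lemma active_flagP : is_flag active_flag.
Proof.
split; rewrite ?size_active_flag //=.
- by rewrite active_flag_take // take0; congr c; apply/setP=> x; rewrite !inE.
- rewrite active_flag_take // take_size -[RHS]closure_actives; congr c.
  by apply/setP=> a; rewrite inE mem_acts.
- move=> [|k] //= lt_k; have a0 : E by case: (acts) lt_k.
  exists (nth a0 acts k); first exact: active_flag_step_min.
  have pA : nth a0 acts k \in A.
    have : nth a0 acts k \in actives by rewrite -mem_acts mem_nth.
    by rewrite inE => /andP[].
  rewrite !active_flag_take // ?(ltnW lt_k) // closure_setU1 //.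
    congr c; apply/setP=> x.
    by rewrite !inE (take_nth a0) // mem_rcons inE.
  apply/subsetP=> x; rewrite inE => /mem_take.
  by rewrite mem_acts inE => /andP[].
move=> [|j] [|k] a b //=; rewrite ltnS => lt_jk lt_k min_a min_b.
have a0 : E by case: (acts) lt_k.
rewrite (is_min_uniq min_a (active_flag_step_min a0 (ltn_trans lt_jk lt_k))).
rewrite (is_min_uniq min_b (active_flag_step_min a0 lt_k)).
rewrite (lt_sorted_ltn_nth a0 acts_sorted) ?inE //.
exact: ltn_trans lt_jk lt_k.
Qed.

End Closure.
End Flags.

(** * The active filtration *)

Lemma decreasing_ind (P : nat -> Prop) n :
  P n -> (forall k, k < n -> P k.+1 -> P k) -> forall k, k <= n -> P k.
Proof.
elim: n => [|n IHn] Pn step k; first by rewrite leqn0 => /eqP->.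
rewrite leq_eqVlt => /predU1P[-> // | le_kn].
by apply: IHn le_kn => [|j /ltnW]; [apply: step | apply: step].
Qed.

Section ActiveFiltration.
Context (d : Order.disp_t) (V : finType) (E : finOrderType d).
Variable D : digraph V E.
Implicit Types (R S X Y C : {set E}) (f : fseq E).

Let A := dedges D.

(** The closure operator of the dual oriented matroid: its closed sets are the
    complements of unions of directed cycles. *)
Definition cocl S : {set E} := A :\: cl D (A :\: S) set0.

Lemma cl_closure : is_closure A (cl D A).
Proof.
split=> [S | S | S T | S]; first exact: cl_sub.
- exact: sub_cl.
- exact: cl_mono.
exact: cl_idem.
Qed.

Lemma cl_core R : cl D (cl D R set0) set0 = cl D R set0.
Proof. by apply: cl_restrict (cl_sub _ _ _) _. Qed.

Lemma cocl_closure : is_closure A cocl.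
Proof.
split=> [S | S sS | S T sST | S sS]; first exact: subsetDl.
- rewrite subsetD sS disjoint_sym disjoint_subset; apply/subsetP=> x.
  by move/(subsetP (cl_sub _ _ _)); rewrite !inE => /andP[].
- by rewrite setDS // cl_mono // setDS.
have sclA : cl D (A :\: S) set0 \subset A.
  exact: subset_trans (cl_sub _ _ _) (subsetDl _ _).
by rewrite /cocl setDDr setDv set0U (setIidPr sclA) cl_core.
Qed.

Lemma setD_below a : A :\: below A a = [set x in A | (a <= x)%O].
Proof.
apply/setP=> x; rewrite !inE; case: (x \in A) => //=.
by rewrite leNgt andbT.
Qed.

Lemma bigcup_dicycle_ge a :
  \bigcup_(C | dicycle D C && min_ge C a) C = cl D (A :\: below A a) set0.
Proof.
have sR := subsetDl A (below A a).
apply/setP=> x; apply/bigcupP/(cl0_dicycleP x sR).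
  case=> C /andP[dC geC] xC.
  exists C; split=> //; apply/subsetP=> y yC; rewrite setD_below inE.
  by rewrite (subsetP (dicycle_sub dC)) //; apply: (min_geP _ xC geC).
case=> C [dC sC xC]; exists C; rewrite // dC.
apply/(min_geP _ xC) => y /(subsetP sC).
by rewrite setD_below inE => /andP[].
Qed.

Lemma bigcup_dicycle : \bigcup_(C | dicycle D C) C = cl D A set0.
Proof.
apply/setP=> x; apply/bigcupP/(cl0_dicycleP x (subxx _)).
  by case=> C dC xC; exists C; split=> //; apply: dicycle_sub.
by case=> C [dC _ xC]; exists C.
Qed.

Lemma dicocycle_sub C : dicocycle D C -> C \subset A.
Proof.
case/andP=> /minsetP[/andP[_ /existsP[B /eqP->]] _] _.
by apply/subsetP=> e; rewrite inE => /andP[].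
Qed.

Lemma below_sub a : below A a \subset A.
Proof. by apply/subsetP=> x; rewrite inE => /andP[]. Qed.

Lemma min_ge_below C a x : C \subset A -> x \in C ->
  min_ge C a = [disjoint C & below A a].
Proof.
move=> sCA xC; rewrite disjoint_subset; apply/(min_geP _ xC)/subsetP=> H y yC.
  by rewrite !inE (subsetP sCA) //= -leNgt H.
by have := H y yC; rewrite !inE (subsetP sCA) //= -leNgt.
Qed.

Lemma bigcup_dicocycle_ge a :
  \bigcup_(C | dicocycle D C && min_ge C a) C = A :\: cl D A (below A a).
Proof.
apply/setP=> x; apply/bigcupP/(setD_cl_dicocycleP x (below_sub a)).
  case=> C /andP[dC geC] xC; exists C; split=> //.
  by rewrite -(min_ge_below _ (dicocycle_sub dC) xC).
case=> C [dC disC xC]; exists C; rewrite // dC.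
by rewrite (min_ge_below _ (dicocycle_sub dC) xC).
Qed.

(** If e is in a set of the family all of whose elements are at least e, it is
    the minimum of this set. *)
Lemma mem_bigcup_min (P : pred {set E}) e :
  (forall C, P C -> C \subset A) ->
  [exists C, P C && is_min C e] =
  (e \in \bigcup_(C | P C && min_ge C e) C).
Proof.
move=> sPA; apply/existsP/bigcupP=> [[C /andP[PC minC]] | [C /andP[PC geC] eC]].
  have /andP[eC leC] := minC; exists C; rewrite // PC.
  by apply/existsP; exists e; rewrite minC /=.
exists C; rewrite PC /is_min eC /=.
by apply/forall_inP/(min_geP _ eC).
Qed.

Lemma active_edgesE : active_edges D = actives A cocl.
Proof.
apply/setP=> e; rewrite in_set mem_bigcup_min; last exact: dicycle_sub.
rewrite bigcup_dicycle_ge [RHS]in_set in_setD negb_and negbK.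
case eA: (e \in A); rewrite ?orbF //=; apply: contraFF eA.
by move/(subsetP (cl_sub _ _ _)); rewrite inE => /andP[].
Qed.

Lemma dual_active_edgesE : dual_active_edges D = actives A (cl D A).
Proof.
apply/setP=> e; rewrite !inE mem_bigcup_min; last exact: dicocycle_sub.
by rewrite bigcup_dicocycle_ge !inE andbC.
Qed.

(** The sets of the cyclic half are complemented, which turns this decreasing
    sequence into an increasing chain of closed sets for [cocl]. *)
Record has_active_flags f : Prop := HasActiveFlags {
  up_flag : is_flag A (cl D A) (Fup f);
  down_flag : is_flag A cocl [seq A :\: F | F <- Fdown f];
  cyc_part : Fcyc f = cl D A set0;
  down_sub : {in Fdown f, forall F : {set E}, F \subset A} }.

Lemma setDDK X : X \subset A -> A :\: (A :\: X) = X.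
Proof. by move=> sX; rewrite setDDr setDv set0U; apply/setIidPr. Qed.

Lemma active_filtrationE : active_filtration D =
  Fseq [seq A :\: F | F <- active_flag A cocl] (cl D A set0)
       (active_flag A (cl D A)).
Proof.
rewrite /active_filtration bigcup_dicycle active_edgesE dual_active_edgesE.
congr Fseq; rewrite ?map_rcons ?setDv; congr rcons.
  rewrite -map_comp; apply: eq_map => a /=; rewrite bigcup_dicycle_ge setDDK //.
  exact: subset_trans (cl_sub _ _ _) (subsetDl _ _).
by apply: eq_map => a; rewrite bigcup_dicocycle_ge setDDK ?cl_sub.
Qed.

Lemma has_active_flagsP f : has_active_flags f <-> f = active_filtration D.
Proof.
rewrite active_filtrationE; split.
  case: f => Fd Fc Fu [/= fu fd -> sub]; congr Fseq; last first.
    exact: (flag_uniq cl_closure fu (active_flagP cl_closure)).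
  rewrite -(flag_uniq cocl_closure fd (active_flagP cocl_closure)) -map_comp.
  by rewrite -[LHS]map_id; apply/eq_in_map => F /sub/setDDK.
move->; split=> //=; first exact: (active_flagP cl_closure).
  rewrite -map_comp map_id_in; first exact: (active_flagP cocl_closure).
  move=> F /=; rewrite mem_rcons inE.
  by case/predU1P=> [-> | /mapP[a _ ->]]; rewrite setDDK ?subsetDl.
by move=> F /mapP[F' _ ->]; apply: subsetDl.
Qed.

Section Orientation.
Variables (G : graph V E) (oGD : orientation G D).

Lemma dedgesE : A = edges G. Proof. by case: oGD. Qed.

Lemma nth_setD f k : k < size (Fdown f) ->
  nth set0 [seq A :\: F | F <- Fdown f] k = A :\: F'_ f k.
Proof. by move=> lt_k; rewrite (nth_map set0). Qed.

Lemma setD_setD X Y : Y \subset A -> (A :\: X) :\: (A :\: Y) = Y :\: X.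
Proof.
by move=> sY; rewrite setDDl setUC -setDDl setDDK.
Qed.

(** All the terms of a flag are closed, so that their relative closures are
    given by [cl_restrict] and [cl_absorb]; they satisfy the criteria of
    [bipolar_minor] and [cyclic_bipolar_minor]. *)
Lemma flags_filtration f : has_active_flags f ->
  filtration G f /\ filtration_orientation G f D.
Proof.
case=> fu fd defc sub.
have [u_gt0 d_gt0] : 0 < size (Fup f) /\ 0 < size (Fdown f).
  split; first exact: flag_nonempty fu.
  by move: (flag_nonempty fd); rewrite size_map.
have upA := flag_closed cl_closure fu.
have downA := flag_closed cocl_closure fd.
have bounds (s : seq {set E}) k : 0 < size s -> 1 <= k <= (size s).-1 ->
    [/\ k = k.-1.+1, k.-1.+1 < size s & k.-1 < size s].
  move=> s_gt0; case: k => //= k lt_k.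
  by rewrite -(prednK s_gt0) !ltnS (ltnW lt_k).
have upS k : 1 <= k <= iota_of f ->
    [/\ k = k.-1.+1, k.-1.+1 < size (Fup f) & k.-1 < size (Fup f)].
  exact: bounds.
have downS k : 1 <= k <= epsilon_of f ->
    [/\ k = k.-1.+1, k.-1.+1 < size (Fdown f) & k.-1 < size (Fdown f)].
  exact: bounds.
have subF k : k < size (Fdown f) -> F'_ f k \subset A.
  by move=> lt_k; apply: sub; apply: mem_nth.
have stepE k : 1 <= k <= epsilon_of f -> down_step f k =
    nth set0 [seq A :\: F | F <- Fdown f] k :\:
    nth set0 [seq A :\: F | F <- Fdown f] k.-1.
  case/downS=> def_k lt_k lt_k1; rewrite !nth_setD // ?setD_setD ?subF //.
  by rewrite def_k.
split; split=> //.
- by rewrite defc; apply: flag_bot fu.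
- rewrite defc; have := flag_bot fd; rewrite nth_setD // /cocl setD0.
  by move/(congr1 (setD A)); rewrite !setDDK ?subF ?cl_sub.
- by rewrite -dedgesE; apply: flag_top fu.
- have := flag_top fd; rewrite size_map nth_setD ?prednK //.
  by move/(congr1 (setD A)); rewrite setDDK ?subF ?prednK // setDv.
- move=> k /upS[def_k lt_k _]; rewrite /F_ {2}def_k.
  exact: (flag_proper cl_closure fu lt_k).
- move=> k /downS[def_k lt_k lt_k1].
  have lt_kd : k.-1.+1 < size [seq A :\: F | F <- Fdown f] by rewrite size_map.
  have := flag_proper cocl_closure fd lt_kd; rewrite !nth_setD // -def_k.
  rewrite -def_k in lt_k.
  rewrite !properEneq => /andP[neq sD]; apply/andP; split.
    by apply: contraNneq neq => ->.
  by have := setDS A sD; rewrite !setDDK ?subF.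
- exact: flag_min fu.
- move=> j k a b lt_jk le_k; rewrite !stepE ?le_k ?andbT //; last 2 first.
  + by case/andP: lt_jk => j0 /ltnW/(leq_trans j0).
  + by case/andP: lt_jk => -> /ltnW le_jk; apply: leq_trans le_k.
  by apply: (flag_min fd) => //; rewrite size_map.
- move=> k k_ok; have [def_k lt_k lt_k1] := upS k k_ok.
  have [p min_p defY] := flag_step fu k_ok; exists p => //.
  have [sYA _] := upA _ lt_k; have [sXA clX] := upA _ lt_k1.
  have sXY := proper_sub (flag_proper cl_closure fu lt_k).
  rewrite -def_k in sYA sXY.
  apply/bipolar_minor => //; split; first by case/andP: min_p.
    by rewrite /F_ (cl_restrict sYA) clX.
  by rewrite /F_ (cl_restrict sYA) -defY.
move=> k k_ok; have [def_k lt_k lt_k1] := downS k k_ok.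
have k_ok' : 1 <= k <= (size [seq A :\: F | F <- Fdown f]).-1.
  by rewrite size_map.
have [p min_p defX] := flag_step fd k_ok'; exists p; first by rewrite stepE.
have closed j : j < size (Fdown f) -> cl D (F'_ f j) set0 = F'_ f j.
  move=> lt_j; have := lt_j; rewrite -(size_map (setD A)) => /downA[_].
  rewrite nth_setD // /cocl => /(congr1 (setD A)).
  by rewrite !setDDK ?subF //; apply: subset_trans (cl_sub _ _ _) (subF _ lt_j).
rewrite -def_k in lt_k.
rewrite -stepE // in min_p; have /andP[pYX _] := min_p.
have pY : p \in F'_ f k.-1 by case/setDP: pYX.
have sRA : F'_ f k.-1 :\ p \subset A.
  exact: subset_trans (subsetDl _ _) (subF _ lt_k1).
have {}defX : F'_ f k = cl D (F'_ f k.-1 :\ p) set0.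
  move: defX; rewrite !nth_setD // /cocl setUC -setDDl setDDK ?subF //.
  move/(congr1 (setD A)); rewrite !setDDK ?subF //.
  exact: subset_trans (cl_sub _ _ _) sRA.
have sXR : F'_ f k \subset F'_ f k.-1 :\ p by rewrite {1}defX cl_sub.
have sXY := subset_trans sXR (subsetDl _ _).
apply/cyclic_bipolar_minor; rewrite // ?subF //; split=> //.
  by rewrite cl_absorb ?closed.
by rewrite cl_absorb ?closed // -defX.
Qed.

(** The minors only give closedness of each term in a neighbouring one.  It
    propagates from the top A down to F_0, and from the bottom, which is empty,
    up to F'_0; where the two halves meet, the middle term is both closed and a
    union of directed cycles, hence the closure of the empty set. *)
Lemma filtration_flags f : filtration G f -> filtration_orientation G f D ->
  has_active_flags f.
Proof.
case=> u_gt0 d_gt0 F0 F'0 top bot up down upmin downmin [_ upM downM].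
have upS k : k < iota_of f -> F_ f k \subset F_ f k.+1.
  by move=> lt_k; apply/proper_sub/(up k.+1).
have downS k : k < epsilon_of f -> F'_ f k.+1 \subset F'_ f k.
  by move=> lt_k; apply/proper_sub/(down k.+1).
have topA : F_ f (iota_of f) = A by rewrite dedgesE.
have upA : forall k, k <= iota_of f -> F_ f k \subset A.
  by apply: decreasing_ind => [|k /upS]; [rewrite topA | apply: subset_trans].
have downA k : k <= epsilon_of f -> F'_ f k \subset A.
  elim: k => [_|k IHk lt_k]; first by rewrite F'0 -F0 upA.
  exact: subset_trans (downS k lt_k) (IHk (ltnW lt_k)).
have upP k : k < iota_of f -> exists p,
    [/\ is_min (F_ f k.+1 :\: F_ f k) p, cl D (F_ f k.+1) (F_ f k) = F_ f k
      & cl D (F_ f k.+1) (p |: F_ f k) = F_ f k.+1].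
  move=> lt_k; have [p min_p b] := upM k.+1 lt_k; exists p.
  by case/bipolar_minor: b => [||_]; rewrite ?upS ?upA.
have closed_up : forall k, k <= iota_of f -> cl D A (F_ f k) = F_ f k.
  apply: decreasing_ind => [|k lt_k clk]; first by rewrite topA cl_full.
  have [p [_ clX _]] := upP k lt_k; rewrite -[RHS]clX; apply/esym/cl_restrict.
    exact: upA.
  by rewrite -clk cl_mono ?upS.
have downP k : k < epsilon_of f -> exists p,
    [/\ is_min (F'_ f k :\: F'_ f k.+1) p, cl D (F'_ f k) (F'_ f k.+1) = F'_ f k
      & cl D (F'_ f k :\ p) (F'_ f k.+1) = F'_ f k.+1].
  move=> lt_k; have [p min_p b] := downM k.+1 lt_k; exists p.
  by case/cyclic_bipolar_minor: b => [||_]; rewrite ?downS ?downA // ltnW.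
have closed_down : forall k, k <= epsilon_of f -> cl D (F'_ f k) set0 = F'_ f k.
  apply: decreasing_ind => [|k lt_k clk]; first by rewrite bot cl_full.
  by have [p [_ clY _]] := downP k lt_k; rewrite -[RHS]clY cl_absorb ?downS.
have def_c : Fcyc f = cl D A set0.
  apply/eqP; rewrite eqEsubset -{1}F'0 -{1}(closed_down 0) //.
  rewrite cl_mono ?downA //=.
  by rewrite -F0 -(closed_up 0) // cl_mono ?sub0set.
have size_u : size (Fup f) = (iota_of f).+1 by rewrite prednK.
have size_d : size (Fdown f) = (epsilon_of f).+1 by rewrite prednK.
have nthD k : k <= epsilon_of f ->
    nth set0 [seq A :\: F | F <- Fdown f] k = A :\: F'_ f k.
  by move=> le_k; rewrite nth_setD // size_d.
have stepD k : 1 <= k <= epsilon_of f ->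
    nth set0 [seq A :\: F | F <- Fdown f] k :\:
    nth set0 [seq A :\: F | F <- Fdown f] k.-1 = down_step f k.
  case: k => //= k lt_k.
  by rewrite !nthD ?(ltnW lt_k) // setD_setD ?downA // ltnW.
split=> //.
- split=> //; first by rewrite -def_c.
  move=> [|k] //= lt_k; have [p [min_p _ defY]] := upP k lt_k; exists p => //.
  rewrite -[LHS]defY; apply: cl_restrict (upA k.+1 lt_k) _.
  rewrite -(closed_up k.+1) // cl_mono // subUset upS //.
  by rewrite andbT sub1set; case/andP: min_p => /setDP[].
- split; rewrite ?size_map ?nthD //.
  + by rewrite F'0 def_c /cocl setD0.
  + by rewrite bot setD0.
  + move=> k k_ok; rewrite stepD //; case: k k_ok => // k lt_k.
    have [p [min_p _ clX]] := downP k lt_k; exists p => //.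
    rewrite !nthD ?(ltnW lt_k) // /cocl setUC -setDDl.
    rewrite setDDK ?downA ?(ltnW lt_k) //.
    rewrite -clX cl_absorb ?closed_down //.
    by rewrite -clX cl_sub.
  move=> j k a b lt_jk le_k; rewrite !stepD ?le_k ?andbT //.
  + exact: downmin.
  + by case/andP: lt_jk => j0 /ltnW/(leq_trans j0).
  by case/andP: lt_jk => -> /ltnW le_jk; apply: leq_trans le_k.
by move=> F /(nthP set0)[k lt_k <-]; apply: downA; rewrite -ltnS -size_d.
Qed.

Lemma flags_connected f : has_active_flags f -> connected_filtration G f.
Proof.
case/flags_filtration=> ff [_ upM downM]; split=> // k k_ok.
  have [p _ bip] := upM k k_ok; apply: (bipolar_block _ bip).
  exact: orientation_minor.
have [p _ bip] := downM k k_ok; apply: (cyclic_bipolar_block _ bip).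
exact: orientation_minor.
Qed.

End Orientation.
End ActiveFiltration.

(** * The partition of the set of orientations *)

Unset Implicit Arguments.

Theorem theorem3p12 (d : Order.disp_t) (V : finType) (E : finOrderType d)
    (G : graph V E) (G_connected : graph_connected G) :
  [/\ forall D : digraph V E,
        orientation G D <->
        (exists f : fseq E,
           connected_filtration G f /\ filtration_orientation G f D),
      forall f1 f2 : fseq E,
        connected_filtration G f1 -> connected_filtration G f2 -> f1 <> f2 ->
        forall D : digraph V E,
          ~ (filtration_orientation G f1 D /\ filtration_orientation G f2 D) &
      forall (f : fseq E) (D : digraph V E),
        connected_filtration G f -> filtration_orientation G f D ->
        f = active_filtration D].
Proof.
have active f D : connected_filtration G f -> filtration_orientation G f D ->
    f = active_filtration D.
  case=> filt_f _ _ ori_f; have [oGD _ _] := ori_f.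
  exact/has_active_flagsP/(filtration_flags oGD).
split=> // [D | f1 f2 cf1 cf2 neq D [o1 o2]].
  split=> [oGD | [f [_ []]] //]; exists (active_filtration D).
  have flags : has_active_flags D (active_filtration D).
    exact/has_active_flagsP.
  by split; [exact: (flags_connected oGD) | case: (flags_filtration oGD flags)].
by apply: neq; rewrite (active _ _ cf1 o1) (active _ _ cf2 o2).
Qed.
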